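(* For every $y_0\in Y$, $$\limsup_{T\to\infty}\Gamma_T(y_0)\subset W\cap D_1(y_0).$$
   Context: Model. $Y\subset\mathbb R^n$ is a nonempty compact set, $\hat U$ is a compact metric space, $S$ is a Polish space. The function $f:Y\times\hat U\times S\to\mathbb R^n$ is bounded, continuous in $(y,u)$ on $Y\times\hat U$ and Borel measurable in $s$ on $S$. The $S$-valued random elements $s(0),s(1),\dots$ are independent and identically distributed on a common probability space; $s$ denotes a generic random element with the same distribution, and $E[\varphi(f(y,u,s))]$ is the expectation over $s$ with $(y,u)$ fixed. $U(\cdot)$ is an upper semicontinuous multivalued map from $Y$ to nonempty compact subsets of $\hat U$, and $f(y,u,s)\in Y$ for all $y\in Y$, $u\in U(y)$, $s\in S$. $G:=\{(y,u): y\in Y,\ u\in U(y)\}$ (a compact set). $\Pi$ is the set of control plans $\pi=\{\pi_t(\cdot)\}_{t=0,1,\dots}$, where each $\pi_t:Y\to\hat U$ is Borel measurable with $\pi_t(y)\in U(y)$ for all $y\in Y$. For $\pi\in\Pi$ and $y_0\in Y$, the state-control trajectory $(y^{\pi,y_0}(\cdot),u^{\pi,y_0}(\cdot))$ is defined by $y(0)=y_0$, $u(t)=\pi_t(y(t))$, $y(t+1)=f(y(t),u(t),s(t))$. $\mathcal P(G)$, $\mathcal M_+(G)$, $\mathcal M(G)$ are the sets of probability, finite nonnegative, and finite signed measures on Borel subsets of $G$; $C(Y)$ is the space of continuous functions on $Y$. Occupational measures: for Borel $Q\subset G$, $\gamma^{\pi,y_0,T}(Q):=\frac1T E[\sum_{t=0}^{T-1}1_Q(y^{\pi,y_0}(t),u^{\pi,y_0}(t))]$,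 and $\Gamma_T(y_0):=\{\gamma^{\pi,y_0,T}:\pi\in\Pi\}$. The set $\limsup_{T\to\infty}\Gamma_T(y_0)$ consists of all $\gamma\in\mathcal P(G)$ for which there are integers $T_l\to\infty$ and $\gamma_l\in\Gamma_{T_l}(y_0)$ with $\gamma_l\to\gamma$ in the weak$^*$ sense (i.e. $\int_Gq\,d\gamma_l\to\int_Gq\,d\gamma$ for all $q\in C(G)$). $$W:=\Big\{\gamma\in\mathcal P(G):\int_G\big(E[\varphi(f(y,u,s))]-\varphi(y)\big)\gamma(dy,du)=0\ \forall\varphi\in C(Y)\Big\}.$$ $D_1(y_0)$ is the set of $\gamma\in\mathcal M(G)$ for which there exist $\xi_l\in\mathcal M_+(G)$, $l=1,2,\dots$, such that $$\int_G(\varphi(y)-\varphi(y_0))\gamma(dy,du)=\lim_{l\to\infty}\int_G\big(E[\varphi(f(y,u,s))]-\varphi(y)\big)\xi_l(dy,du)\quad\forall\varphi\in C(Y).$$ *)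

(* Defs.v *)
From HB Require Import structures.
From mathcomp Require Import all_boot all_order all_algebra.
From mathcomp Require Import all_classical all_reals all_analysis.

Set Implicit Arguments.
Unset Strict Implicit.
Unset Printing Implicit Defensive.

Import Order.TTheory GRing.Theory Num.Theory.
Import numFieldNormedType.Exports.

Local Open Scope classical_set_scope.
Local Open Scope ring_scope.

(* [measurableType]s are pointed, so a metric space that is to carry its Borel
   sigma-algebra must be pointed (that is, nonempty) too. *)
#[short(type="pmetricType")]
HB.structure Definition PointedMetric (K : numDomainType) :=
  {M of Metric K M & Pointed M}.

Notation borel T := (g_sigma_algebraType (@open T)).

Definition is_metric (R : realType) (S : Type) (d : S -> S -> R) :=
  [/\ forall x y, (d x y = 0) <-> (x = y),
      forall x y, d x y = d y x &
      forall x y z, d x z <= d x y + d y z].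

Definition metrizes (R : realType) (S : topologicalType) (d : S -> S -> R) :=
  forall (x : S) (A : set S),
    nbhs x A <-> exists2 e, 0 < e & [set y | d x y < e] `<=` A.

Definition complete_metric (R : realType) (S : topologicalType)
    (d : S -> S -> R) :=
  forall u : nat -> S,
    (forall e, 0 < e -> exists N, forall i j,
       (N <= i)%N -> (N <= j)%N -> d (u i) (u j) < e) ->
    exists l : S, u @ \oo --> l.

Definition polish_space (R : realType) (S : topologicalType) :=
  (exists2 D : set S, countable D & dense D) /\
  exists d : S -> S -> R, [/\ is_metric d, metrizes d & complete_metric d].

Definition iid (R : realType) (d d' : measure_display)
    (Omega : measurableType d) (P : probability Omega R)
    (S : measurableType d') (s : nat -> Omega -> S) (mu : probability S R) :=
  [/\ forall t, measurable_fun setT (s t),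
      forall t (A : set S), measurable A -> P (s t @^-1` A) = mu A &
      forall (J : seq nat) (A : nat -> set S), uniq J ->
        (forall t, measurable (A t)) ->
        P (\bigcap_(t in [set` J]) (s t @^-1` A t)) =
        (\prod_(t <- J) P (s t @^-1` A t))%E].

Definition upper_semicontinuous_on (X Z : topologicalType) (Y : set X)
    (U : X -> set Z) :=
  forall y, Y y -> forall V : set Z, open V -> U y `<=` V ->
    \forall y' \near within Y (nbhs y), U y' `<=` V.

Section charge_integral.
Context (R : realType) (d : measure_display) (T : measurableType d).
Variable nu : {charge set T -> \bar R}.

Definition hahn_pos : set T := sval (cid (Hahn_decomposition nu)).

Definition hahn_neg : set T := sval (cid (svalP (cid (Hahn_decomposition nu)))).

Definition hahnP : hahn_decomposition nu hahn_pos hahn_neg :=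
  svalP (cid (svalP (cid (Hahn_decomposition nu)))).

Definition charge_integral (D : set T) (q : T -> R) : R :=
  \int[jordan_pos hahnP]_(x in D) q x - \int[jordan_neg hahnP]_(x in D) q x.

End charge_integral.

(* A measure (finite, probability or signed) on the Borel subsets of G is
   encoded as one on the ambient space that vanishes outside G. *)
Definition concentrated_on (R : realType) (d : measure_display)
    (T : measurableType d) (m : set T -> \bar R) (G : set T) :=
  forall A, measurable A -> A `&` G = set0 -> m A = 0%E.

Section model.
Context (R : realType) (n : nat) (Uh : pmetricType R) (S : ptopologicalType).
Variables (Y : set 'rV[R]_n) (U : 'rV[R]_n -> set Uh).
Variable f : 'rV[R]_n -> Uh -> S -> 'rV[R]_n.

Local Notation XU := ('rV[R]_n * Uh)%type.
Local Notation BXU := (borel XU).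

Definition graph : set XU := [set p | Y p.1 /\ U p.1 p.2].

Definition plan (pi : nat -> 'rV[R]_n -> Uh) :=
  forall t,
    measurable_fun (Y : set (borel 'rV[R]_n))
      (pi t : borel 'rV[R]_n -> borel Uh) /\
    (forall y, Y y -> U y (pi t y)).

(* E[phi(f(y,u,s))], where mu is the law of s *)
Definition mean_next (mu : probability (borel S) R) (phi : 'rV[R]_n -> R)
    (y : 'rV[R]_n) (u : Uh) : R :=
  \int[mu]_x phi (f y u x).

Section occupational_measures.
Context (d : measure_display) (Omega : measurableType d).
Variables (P : probability Omega R) (s : nat -> Omega -> S).

Fixpoint state (pi : nat -> 'rV[R]_n -> Uh) (y0 : 'rV[R]_n) (t : nat)
    (w : Omega) : 'rV[R]_n :=
  if t is t'.+1 then
    let y := state pi y0 t' w in f y (pi t' y) (s t' w)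
  else y0.

Definition control (pi : nat -> 'rV[R]_n -> Uh) (y0 : 'rV[R]_n) (t : nat)
    (w : Omega) : Uh :=
  pi t (state pi y0 t w).

Definition occupational (pi : nat -> 'rV[R]_n -> Uh) (y0 : 'rV[R]_n) (T : nat)
    (Q : set XU) : \bar R :=
  ((T%:R^-1)%:E *
   'E_P[fun w => (\sum_(0 <= t < T)
          \1_Q (state pi y0 t w, control pi y0 t w))%R])%E.

(* For T = 0 this is empty, since the right-hand side below then vanishes. *)
Definition Gamma (y0 : 'rV[R]_n) (T : nat) :
    set (probability BXU R) :=
  [set gam : probability BXU R | concentrated_on gam graph /\
     exists2 pi, plan pi &
       forall Q : set BXU,
         measurable Q -> Q `<=` graph -> gam Q = occupational pi y0 T Q].

Definition limsup_Gamma (y0 : 'rV[R]_n) :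
    set (probability BXU R) :=
  [set gam : probability BXU R | concentrated_on gam graph /\
     exists (T_ : nat -> nat)
       (gam_ : nat -> probability BXU R),
       [/\ T_ @ \oo --> \oo,
           forall l, Gamma y0 (T_ l) (gam_ l) &
           forall q : XU -> R, {within graph, continuous q} ->
             \int[gam_ l]_(p in graph) q p @[l --> \oo] -->
             \int[gam]_(p in graph) q p]].

End occupational_measures.

Definition W (mu : probability (borel S) R) :
    set (probability BXU R) :=
  [set gam : probability BXU R | concentrated_on gam graph /\
     forall phi : 'rV[R]_n -> R, {within Y, continuous phi} ->
       \int[gam]_(p in graph) (mean_next mu phi p.1 p.2 - phi p.1) = 0].

Definition D1 (mu : probability (borel S) R) (y0 : 'rV[R]_n) :
    set ({charge set BXU -> \bar R}) :=
  [set nu : {charge set BXU -> \bar R} | concentrated_on nu graph /\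
     exists xi_ : nat ->
         {finite_measure set BXU -> \bar R},
       (forall l, concentrated_on (xi_ l) graph) /\
       forall phi : 'rV[R]_n -> R, {within Y, continuous phi} ->
         \int[xi_ l]_(p in graph) (mean_next mu phi p.1 p.2 - phi p.1)
           @[l --> \oo] -->
         charge_integral nu graph (fun p => phi p.1 - phi y0)].

End model.

(* Main.v *)
(* The pair (y(t), u(t)) is a function of s(0), ..., s(t-1), hence independent of
   s(t), so that E[phi(y(t+1))] = E[m(y(t), u(t))] with m(y, u) = E[phi(f(y, u, s))].
   Summing over t < T, the integral of m - phi against the occupational measure
   telescopes to (E[phi(y(T))] - phi(y0)) / T, which vanishes in the limit. Summing
   twice expresses the integral of phi - phi(y0) as the integral of m - phi against
   xi = (1/T) sum_(t < T) sum_(r < t) law (y(r), u(r)). Both integrands are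
   continuous on the graph of U, so the identities pass to weak limits. *)

From HB Require Import structures.
Require Import Defs.
From mathcomp Require Import all_boot all_order all_algebra.
From mathcomp Require Import all_classical all_reals all_analysis.
From mathcomp Require Import measurable_realfun.

Set Implicit Arguments.
Unset Strict Implicit.
Unset Printing Implicit Defensive.

Import Order.TTheory GRing.Theory Num.Theory.
Import numFieldNormedType.Exports.
Local Open Scope classical_set_scope.
Local Open Scope ring_scope.

(** * Measurability tested on open sets, and Carathéodory maps *)

(** Testing on open sets only asks the codomain for a topology, so products and pseudometric spaces
    can be used without fixing a sigma-algebra on them. For a pointed codomain with its Borel sets
    and a measurable [D], this is [measurable_fun], by [measurable_fun_g_sigma_algebra] below. *)
Definition open_measurable_fun d (X : measurableType d) (T : topologicalType)
    (D : set X) (h : X -> T) :=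
  forall O, open O -> measurable (D `&` h @^-1` O).

Lemma measurable_fun_g_sigma_algebra d (X : measurableType d) (T : pointedType)
    (C : set (set T)) (D : set X) (h : X -> T) : measurable D ->
  measurable_fun D (h : X -> g_sigma_algebraType C) <->
  forall V, C V -> measurable (D `&` h @^-1` V).
Proof.
move=> mD; split=> [mh V CV | mh].
  by apply: mh => //; exact: sub_sigma_algebra.
by apply: (@measurability _ _ X (g_sigma_algebraType C) D h C) => // _ [V oV <-];
  exact: mh.
Qed.

(* With V_m the interior of {x | ball x (1/m) `<=` O}, the limit lies in O iff for
   some m the sequence is eventually in V_m. *)
Lemma open_measurable_cvg (R : realType) d (X : measurableType d)
    (T : pseudoMetricType R) (D : set X) (h_ : nat -> X -> T) (h : X -> T) :
  (forall k, open_measurable_fun D (h_ k)) ->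
  (forall x, D x -> h_ ^~ x @ \oo --> h x) -> open_measurable_fun D h.
Proof.
move=> mh cvh O oO.
pose V m := interior [set x : T | ball x m.+1%:R^-1 `<=` O].
suff -> : D `&` h @^-1` O =
    \bigcup_m \bigcup_N \bigcap_k (D `&` h_ (N + k)%N @^-1` V m).
  apply: bigcupT_measurable => m; apply: bigcupT_measurable => N.
  by apply: bigcapT_measurable => k; apply: mh; exact: open_interior.
apply/seteqP; split=> x /=.
- move=> [Dx Ohx]; have /nbhs_ballP[e /= e0 eO] : nbhs (h x) O.
    exact: open_nbhs_nbhs.
  have [m me] : exists m, m.+1%:R^-1 < e / 2 :> R.
    have e20 : 0 < e / 2 by rewrite divr_gt0.
    have [m _ H] := near_infty_natSinv_lt (PosNum e20).
    by exists m; exact: (H m (leqnn m)).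
  have m0 : 0 < m.+1%:R^-1 :> R by rewrite invr_gt0.
  have Vhx : V m (h x).
    apply/nbhs_ballP; exists m.+1%:R^-1 => //= y hy z yz; apply: eO.
    apply: (@le_ball _ _ _ (m.+1%:R^-1 + m.+1%:R^-1)); last exact: ball_triangle hy yz.
    by rewrite [leRHS]splitr lerD// ltW.
  have := cvh x Dx => /(_ (V m)).
  move=> /(_ (open_nbhs_nbhs (conj (@open_interior _ _) Vhx)))[N _ HN].
  exists m => //; exists N => // k _; split => //.
  by apply: HN => /=; rewrite leq_addr.
- move=> [m _ [N _ H]].
  have Dx : D x by have [] := H 0%N I.
  split => //.
  have m0 : 0 < m.+1%:R^-1 :> R by rewrite invr_gt0.
  have [M _ HM] := cvh x Dx _ (nbhsx_ballx _ _ m0).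
  have /= := HM (N + M)%N (leq_addl _ _) => /ball_sym hh.
  by have [_ /interior_subset/(_ _ hh)] := H M I.
Qed.

(** Interiors appear because a ball of a pseudometric space need not be open. Openness serves twice:
    for extracting the finite cover, and later for the measurability of preimages. *)
Lemma compact_finite_ball_cover (R : realType) (Z : pseudoMetricType R)
    (B : set Z) (e : R) : compact B -> 0 < e ->
  exists2 l : seq Z, {in l, forall x, B x} &
    forall z, B z -> exists2 x, x \in l & interior (ball x e) z.
Proof.
move=> cB e0.
have [[b Bb]|nB] := pselect (B !=set0); last first.
  by exists [::] => // z Bz; exfalso; apply: nB; exists z.
(* [compact_cover] speaks of pointed spaces; the point [b] of [B] serves as base point. *)
pose ZP : ptopologicalType := HB.pack_for ptopologicalType Z (isPointed.Build Z b).
have := @compact_cover ZP; move/(congr1 (fun F => F B)) => /= cE.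
have : cover_compact (T := ZP) B by rewrite -cE.
move=> /(_ Z B (fun x => interior (ball x e))) [].
- by move=> x _; exact: open_interior.
- move=> z Bz; exists z => //; exact: nbhsx_ballx.
move=> l lB Bl; exists (finmap.enum_fset l).
  by move=> x xl; have := lB x xl; rewrite inE.
by move=> z /Bl[x /= xl zx]; exists x.
Qed.

(** A finitely valued approximation of the identity: [z] is sent to the first centre in [c] that is
    [e]-close to it. The value [b] is a default, not attained by the recursion where the balls
    cover. *)
Fixpoint first_near (R : realType) (Z : pseudoMetricType R) (e : R) (b : Z)
    (c : seq Z) (z : Z) : Z :=
  if c is x :: c' then
    if `[< interior (ball x e) z >] then x else first_near e b c' z
  else b.

Lemma first_near_closed (R : realType) (Z : pseudoMetricType R) (B : set Z)
    (e : R) (b : Z) (c : seq Z) (z : Z) :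
  B b -> {in c, forall x, B x} -> B (first_near e b c z).
Proof.
move=> Bb; elim: c => //= x c IHc Bc; case: asboolP => _.
  by apply: Bc; rewrite mem_head.
by apply: IHc => y yc; apply: Bc; rewrite inE yc orbT.
Qed.

Lemma first_near_ball (R : realType) (Z : pseudoMetricType R)
    (e : R) (b : Z) (c : seq Z) (z : Z) :
  (exists2 x, x \in c & interior (ball x e) z) -> ball (first_near e b c z) e z.
Proof.
elim: c => [[]//|x c IHc] [y]; rewrite inE /= => /predU1P[->|yc] yz.
  by case: asboolP => // _; exact: interior_subset.
by case: asboolP => [/interior_subset//|_]; apply: IHc; exists y.
Qed.

(** On the preimage [A] of the first open ball the map is [F z], and off [A] it is the map of the
    shorter list. Induction on the list glues these finitely many measurable pieces. *)
Lemma first_near_measurable (R : realType) d (X : measurableType d)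
    (Z : pseudoMetricType R) (T : topologicalType) (D : set X) (h : X -> Z)
    (F : Z -> X -> T) (e : R) (b : Z) (c : seq Z) :
  measurable D -> open_measurable_fun D h ->
  open_measurable_fun D (F b) ->
  {in c, forall z, open_measurable_fun D (F z)} ->
  open_measurable_fun D (fun x => F (first_near e b c (h x)) x).
Proof.
move=> mD mh mb; elim: c => [//|z c IHc] mc V oV.
set A := D `&` h @^-1` (interior (ball z e)).
have mA : measurable A by apply: mh; exact: open_interior.
have mFz : measurable (D `&` F z @^-1` V) by apply: mc => //; rewrite mem_head.
have mI : measurable (D `&` (fun x => F (first_near e b c (h x)) x) @^-1` V).
  by apply: IHc => // y yc; apply: mc; rewrite inE yc orbT.
rewrite [X in measurable X](_ : _ = (A `&` (D `&` F z @^-1` V)) `|`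
    ((D `&` (fun x => F (first_near e b c (h x)) x) @^-1` V) `\` A)).
  by apply: measurableU; [exact: measurableI|exact: measurableD].
apply/seteqP; split=> x /=; rewrite /A /=.
  by move=> [Dx]; case: asboolP => zh Fx; [left|right]; split=> // -[].
move=> [[[_ zh] [Dx Fx]]|[[Dx Fx] /not_andP[//|zh]]]; split => //.
  by rewrite asboolT.
by rewrite asboolF.
Qed.

Lemma within_continuous_cvg (Z T : topologicalType) (B : set Z) (g : Z -> T)
    (u : nat -> Z) (z : Z) : {within B, continuous g} ->
  (forall k, B (u k)) -> B z -> u @ \oo --> z -> (g \o u) @ \oo --> g z.
Proof.
move=> /subspace_continuousP gc Bu Bz uz V /(gc z Bz) gV.
have {}gV : nbhs z [set x | B x -> V (g x)] by exact: gV.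
by have [N _ HN] := uz _ gV; exists N => // k /= /HN; apply.
Qed.

(* h is a pointwise limit of maps with finitely many values in B. *)
Lemma measurable_caratheodory_fun (R : realType) d (X : measurableType d)
    (Z T : pseudoMetricType R) (B : set Z) (D : set X) (h : X -> Z)
    (F : Z -> X -> T) :
  compact B -> measurable D -> open_measurable_fun D h ->
  (forall x, D x -> B (h x)) ->
  (forall z, B z -> open_measurable_fun D (F z)) ->
  (forall x, D x -> {within B, continuous (F ^~ x)}) ->
  open_measurable_fun D (fun x => F (h x) x).
Proof.
move=> cB mD mh Bh mF cF.
have [[x0 Dx0]|/set0P/negP/negPn/eqP ->] := pselect (D !=set0); last first.
  by move=> V _; rewrite set0I.
have e0 k : 0 < k.+1%:R^-1 :> R by rewrite invr_gt0.
have /choice[c cP] k : exists c : seq Z, {in c, forall x, B x} /\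
    forall z, B z -> exists2 x, x \in c & interior (ball x k.+1%:R^-1) z.
  by have [c] := compact_finite_ball_cover cB (e0 k); exists c.
(* The default [h x0] lies in [B], so every value of [g k] does, and [g k x] is within [1/(k+1)] of
   [h x] for [x] in [D]. Continuity of [F] on [B] then gives the pointwise limit. *)
pose g k x := first_near k.+1%:R^-1 (h x0) (c k) (h x).
have Bg k x : B (g k x).
  by apply: first_near_closed; [exact: Bh|exact: (cP k).1].
apply: (@open_measurable_cvg R _ X T D (fun k x => F (g k x) x)) => [k|x Dx].
  apply: first_near_measurable => //; first exact/mF/Bh.
  by move=> z /(cP k).1; exact: mF.
apply: (within_continuous_cvg (cF x Dx) _ (Bh x Dx)) => // V.
move=> /nbhs_ballP[e /= e0' eV].
have [N _ HN] := near_infty_natSinv_lt (PosNum e0').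
exists N => // k /= Nk; apply: eV; apply: ball_sym.
apply: (@le_ball _ _ _ k.+1%:R^-1); first exact/ltW/HN.
by apply: first_near_ball; exact/(cP k).2/Bh.
Qed.

Lemma within_continuous_measurable d (X : measurableType d)
    (Z T : topologicalType) (B : set Z) (D : set X) (g : Z -> T) (h : X -> Z) :
  {within B, continuous g} -> open_measurable_fun D h ->
  (forall x, D x -> B (h x)) -> open_measurable_fun D (g \o h).
Proof.
move=> /continuousP cg mh Bh V oV.
have /open_subspaceP[V' oV' V'E] := cg _ oV.
rewrite [X in measurable X](_ : _ = D `&` h @^-1` V'); first exact: mh.
apply/seteqP; split=> x [Dx /= hx]; split => //.
  have : (g @^-1` V `&` B) (h x) by split => //; exact: Bh.
  by rewrite -V'E => -[].
have : (V' `&` B) (h x) by split => //; exact: Bh.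
by rewrite V'E => -[].
Qed.

(** An open set of the product need not be a countable union of open rectangles, so coordinatewise
    preimages do not settle the claim. Instead the pair is the Carathéodory map sending [(u, x)] to
    [(h1 x, u)], evaluated at [u = h2 x]; compactness of [Z2] makes this work. *)
Lemma open_measurable_fun_pair (R : realType) d (X : measurableType d)
    (Z1 Z2 : pseudoMetricType R) (D : set X) (h1 : X -> Z1) (h2 : X -> Z2) :
  compact [set: Z2] -> measurable D ->
  open_measurable_fun D h1 -> open_measurable_fun D h2 ->
  open_measurable_fun D (fun x => (h1 x, h2 x)).
Proof.
move=> cZ2 mD mh1 mh2.
apply: (@measurable_caratheodory_fun _ _ _ Z2 (Z1 * Z2)%type setT D h2
  (fun u x => (h1 x, u))) => //.
- move=> u _; apply: (within_continuous_measurable (B := setT)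
    (g := fun y => (y, u)) _ mh1) => //.
  by apply: continuous_subspaceT => y; apply: cvg_pair => //; exact: cvg_cst.
- move=> x _; apply: continuous_subspaceT => u.
  by apply: cvg_pair => //; exact: cvg_cst.
Qed.

Lemma open_measurable_realfun (R : realType) d (X : measurableType d)
    (D : set X) (h : X -> R) :
  open_measurable_fun D h -> measurable_fun D h.
Proof.
move=> mh; apply: (measurability _ (RGenOInfty.measurableE R)) => _ [_ [a ->] <-].
by apply: mh; exact: interval_open.
Qed.

Lemma measurable_realfun_open (R : realType) d (X : measurableType d)
    (D : set X) (h : X -> R) : measurable D ->
  measurable_fun D h -> open_measurable_fun D h.
Proof. by move=> mD mh V oV; apply: mh => //; exact: open_measurable. Qed.

Lemma bounded_integrable (R : realType) d (X : measurableType d)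
    (m : {finite_measure set X -> \bar R}) (D : set X) (q : X -> R) (M : R) :
  measurable D -> measurable_fun D q -> (forall x, D x -> `|q x| <= M) ->
  m.-integrable D (EFin \o q).
Proof.
move=> mD mq qM; apply: measurable_bounded_integrable => //.
  by rewrite -ge0_fin_numE//; exact: fin_num_measure.
exists M; split; first exact: num_real.
by move=> x Mx y Dy; exact/(le_trans (qM _ Dy))/ltW.
Qed.

(** * Independence, and the history of the noise *)

Section independence.
Context (R : realType) (d d1 d2 : measure_display) (Omega : measurableType d)
  (T1 : measurableType d1) (T2 : measurableType d2).
Variables (P : probability Omega R) (mu : probability T2 R).
Variables (h : {mfun Omega >-> T1}) (s : {mfun Omega >-> T2}).
Hypothesis hs : forall A B, measurable A -> measurable B ->
  P (h @^-1` A `&` s @^-1` B) = (P (h @^-1` A) * mu B)%E.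

(** By [hs] the joint law of [h] and [s] agrees on rectangles with the product of the law of [h] and
    [mu], hence equals it. Fubini then integrates out the second variable, and the outer integral is
    carried back to [P]. *)
Lemma Rintegral_independent (H : T1 * T2 -> R) (M : R) :
  measurable_fun setT H -> (forall p, `|H p| <= M) ->
  \int[P]_w H (h w, s w) = \int[P]_w \int[mu]_x H (h w, x).
Proof.
move=> mH HM.
have mhs : measurable_fun setT (fun w => (h w, s w)).
  exact: measurable_fun_pair.
pose hsm : {mfun Omega >-> (T1 * T2)%type} := HB.pack (fun w => (h w, s w))
  (isMeasurableFun.Build _ _ _ _ _ mhs).
have mE : measurable_fun setT (EFin \o H) by exact/measurable_EFinP.
have iHhs : P.-integrable setT (EFin \o H \o hsm).
  apply: (@bounded_integrable _ _ _ P setT (H \o hsm) M) => //.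
  - exact: measurableT_comp.
  - by move=> x _; exact: HM.
have iHP : (distribution P h \x mu)%E.-integrable setT (EFin \o H).
  apply: measurable_bounded_integrable => //.
    have E : (distribution P h \x mu)%E [set: T1 * T2] = 1%E.
      rewrite -setXTT product_measure1E// -[RHS]mule1.
      by congr (_ * _)%E; exact: probability_setT.
    by apply: (@le_lt_trans _ _ 1%E); [rewrite -E|exact: ltry].
  exists M; split; first exact: num_real.
  by move=> x Mx p _; exact/(le_trans (HM p))/ltW.
rewrite /Rintegral -(integral_distribution (X := hsm) mE iHhs).
rewrite (eq_measure_integral (distribution P h \x mu)%E); last first.
  by move=> A mA _; apply/esym; apply: product_measure_unique.
rewrite -integral12_prod_meas1//.
rewrite (integral_distribution (X := h)).
- congr fine; apply: eq_integral => w _; rewrite /fubini_F /=.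
  apply/esym/fineK; apply: integrable_fin_num => //.
  apply: (@bounded_integrable _ _ _ mu setT (fun x => H (h w, x)) M) => //.
  by apply: measurableT_comp => //; exact: measurable_pair1.
- exact: measurable_fubini_F iHP.
- apply/integrableP; split.
    by apply: measurableT_comp => //; exact: measurable_fubini_F iHP.
  have /integrableP[mF] := integrable_fubini_F iHP.
  rewrite ge0_integral_distribution//.
  exact: measurableT_comp.
Qed.

End independence.

Section past.
Context (R : realType) (d d' : measure_display) (Omega : measurableType d)
  (S : measurableType d').
Variables (P : probability Omega R) (s : nat -> Omega -> S).
Variable mu : probability S R.
Hypothesis iids : iid P s mu.

(** These sets form a pi-system generating the sigma-algebra of [s 0], ..., [s (t - 1)], which suits
    the uniqueness theorem for measures. For [t = 0] the only cylinder is the whole space, so the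
    past is trivial. *)
Definition past_cylinder (t : nat) : set (set Omega) :=
  [set C | exists2 A : nat -> set S, (forall i, measurable (A i)) &
     C = \bigcap_(i < t) s i @^-1` A i].

Notation past t := (g_sigma_algebraType (past_cylinder t)).

Lemma setI_closed_past_cylinder t : setI_closed (past_cylinder t).
Proof.
move=> _ _ [A mA ->] [B mB ->]; exists (fun i => A i `&` B i).
  by move=> i; exact: measurableI.
by rewrite -bigcapI.
Qed.

Lemma past_cylinder_setT t : past_cylinder t setT.
Proof.
by exists (fun=> setT) => //; apply/seteqP; split.
Qed.

Lemma past_cylinder_measurable t : past_cylinder t `<=` measurable.
Proof.
move=> _ [A mA ->]; apply: fin_bigcap_measurable => [|i _].
  exact: finite_II.
by have [ms _ _] := iids; rewrite -[X in measurable X]setTI; exact: ms.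
Qed.

Lemma past_measurable t (A : set Omega) :
  measurable (A : set (past t)) -> measurable A.
Proof.
by apply: smallest_sub; [exact: sigma_algebra_measurable|
  exact: past_cylinder_measurable].
Qed.

Lemma past_measurable_fun t d1 (T1 : measurableType d1) (h : Omega -> T1) :
  measurable_fun setT (h : past t -> T1) -> measurable_fun setT h.
Proof.
move=> mh _ A mA; apply: (@past_measurable t).
by apply: mh => //; exact: measurableT.
Qed.

Lemma past_measurableS t (A : set Omega) :
  measurable (A : set (past t)) -> measurable (A : set (past t.+1)).
Proof.
apply: smallest_sub; first exact: smallest_sigma_algebra.
move=> _ [A' mA ->]; apply: sub_sigma_algebra.
exists (fun i => if (i < t)%N then A' i else setT).
  by move=> i; case: ifP.
apply/seteqP; split=> w H i /= it.
  by case: ifPn => // it'; exact: H.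
by have := H i (ltnW it); rewrite it.
Qed.

Lemma measurable_past_last t : measurable_fun setT (s t : past t.+1 -> S).
Proof.
move=> _ A mA; apply: sub_sigma_algebra.
exists (fun i => if i == t then A else setT); first by move=> i; case: ifP.
rewrite setTI; apply/seteqP; split=> w /=.
  by move=> Aw i _; case: eqP => [->|].
by move/(_ t); rewrite eqxx; apply => /=.
Qed.

Lemma past_independent t (A : set Omega) (B : set S) :
  measurable (A : set (past t)) -> measurable B ->
  P (A `&` s t @^-1` B) = (P A * mu B)%E.
Proof.
move=> mA mB; have [ms sE sI] := iids.
have msB : measurable (s t @^-1` B).
  by rewrite -[X in measurable X]setTI; exact: ms.
pose r : {nonneg R} := NngNum (fine_ge0 (measure_ge0 mu B)).
have rE : r%:num%:E = mu B by rewrite /= fineK//; exact: fin_num_measure.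
rewrite muleC -rE.
apply: (@g_sigma_algebra_measure_unique _ R Omega (past_cylinder t) _
  (fun=> setT) _ _ (mrestr P msB) (mscale r P)) => //.
- exact: past_cylinder_measurable.
- by move=> _; exact: past_cylinder_setT.
- by apply: bigcup_const; exists 0%N.
- exact: setI_closed_past_cylinder.
- move=> _ [C mC ->].
  suff : P (\bigcap_(i < t) s i @^-1` C i `&` s t @^-1` B) =
      (mu B * P (\bigcap_(i < t) s i @^-1` C i))%E by rewrite -rE.
  (* Placing [B] at index [t] turns the cylinder and the event of [s t] into one intersection over
     [iota 0 t.+1]. The product formula is applied to this list and to [iota 0 t]; the quotient is
     the factor [mu B]. *)
  pose C' i := if i == t then B else C i.
  have mC' i : measurable (C' i) by rewrite /C'; case: ifP.
  have bigE (u : nat) : \bigcap_(i in [set` iota 0 u]) (s i @^-1` C' i) =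
      \bigcap_(i < u) (s i @^-1` C' i).
    suff -> : [set` iota 0 u] = `I_u by [].
    by apply/seteqP; split=> i /=; rewrite mem_iota.
  have capE : \bigcap_(i < t) s i @^-1` C' i = \bigcap_(i < t) s i @^-1` C i.
    by apply: eq_bigcapr => i /= it; rewrite /C' ltn_eqF.
  have C't : C' t = B by rewrite /C' eqxx.
  have := sI (iota 0 t.+1) C' (iota_uniq _ _) mC'.
  have <- : iota 0 t ++ [:: t] = iota 0 t.+1 by rewrite -[t.+1]addn1 iotaD.
  rewrite big_cat big_seq1 /= -sI ?iota_uniq// bigE capE C't sE// muleC => <-.
  have -> : [set` iota 0 t ++ [:: t]] = `I_t.+1.
    have tE i : (i < t.+1)%N = (i < t)%N || (i == t).
      by rewrite ltnS leq_eqVlt orbC.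
    by apply/seteqP; split=> i /=; rewrite mem_cat mem_seq1 mem_iota /= add0n tE.
  congr (P _); rewrite -capE -C't; apply/seteqP; split=> w /=.
    by move=> [H Ht] i /=; rewrite ltnS leq_eqVlt => /predU1P[->//|]; exact: H.
  by move=> H; split=> [i it|]; apply: H => //=; exact: ltnW.
- move=> _; apply: (@le_lt_trans _ _ 1%E); last exact: ltry.
  by apply: probability_le1; exact: measurableI.
Qed.

End past.

(** * Continuity of parameter integrals, and compactness of the graph *)

(** If continuity failed at [z], there would be points [u k] of [B] tending to [z] whose integrals
    stay at distance at least [e] from that at [z]. Dominated convergence, with the constant [M] as
    dominating function, forbids this. *)
Lemma within_continuous_Rintegral (R : realType) d (X : measurableType d)
    (mu : {finite_measure set X -> \bar R}) (Z : pseudoMetricType R)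
    (B : set Z) (F : Z -> X -> R) (M : R) :
  (forall z, B z -> measurable_fun setT (F z)) ->
  (forall z x, B z -> `|F z x| <= M) ->
  (forall x, {within B, continuous (F ^~ x)}) ->
  {within B, continuous (fun z => \int[mu]_x F z x)}.
Proof.
move=> mF FM cF; apply/subspace_continuousP => z Bz.
apply/cvgrPdist_lt => e e0; apply: contrapT => nz.
have /choice[u uP] k : exists y, [/\ B y, ball z k.+1%:R^-1 y &
    e <= `|\int[mu]_x F z x - \int[mu]_x F y x|].
  apply: contrapT => /forallNP ny; apply: nz.
  have k0 : 0 < k.+1%:R^-1 :> R by rewrite invr_gt0.
  apply/nbhs_ballP; exists k.+1%:R^-1 => //= y zy By /=.
  by rewrite ltNge; apply/negP => ey; exact: (ny y).
have uz : u @ \oo --> z.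
  move=> V /nbhs_ballP[r /= r0 rV].
  have [N _ HN] := near_infty_natSinv_lt (PosNum r0).
  exists N => // k /= Nk; apply: rV; have [_ + _] := uP k.
  by apply: le_ball; exact/ltW/HN.
have Bu k : B (u k) by have [] := uP k.
have iF y : B y -> mu.-integrable setT (EFin \o F y).
  move=> By; apply: (@bounded_integrable _ _ _ mu setT (F y) M) => //.
    exact: mF.
  by move=> x _; exact: FM.
have iM : mu.-integrable setT (EFin \o cst M).
  by apply: (@bounded_integrable _ _ _ mu setT (cst M) `|M|).
have cvF : {ae mu, forall x, setT x ->
    (fun k => (F (u k) x)%:E) @ \oo --> (F z x)%:E}.
  apply: aeW => x _; apply: cvg_EFin; first exact: nearW.
  exact: (within_continuous_cvg (cF x) Bu Bz uz).
have domF : {ae mu, forall x k, setT x -> (`|(F (u k) x)%:E| <= M%:E)%E}.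
  by apply: aeW => x k _ /=; rewrite lee_fin FM.
have [_ _] := dominated_convergence measurableT
  (fun k => measurable_int _ (iF _ (Bu k))) (measurable_int _ (iF _ Bz))
  cvF iM domF.
have fz : (\int[mu]_x (F z x)%:E)%E \is a fin_num.
  by apply: integrable_fin_num => //; exact: iF.
rewrite -(fineK fz) => /fine_cvgP[_ /cvgrPdist_lt/(_ _ e0)[N _ HN]].
have := HN N (leqnn N).
have [_ _ eN] := uP N; rewrite ltNge => /negP H; exact: H.
Qed.

Section graph.
Context (R : realType) (Uh : pmetricType R) (n : nat) (Y : set 'rV[R]_n)
  (U : 'rV[R]_n -> set Uh).
Hypotheses (cY : compact Y) (cUh : compact [set: Uh]).
Hypothesis uscU : upper_semicontinuous_on Y U.
Hypothesis cU : forall y, Y y -> compact (U y).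

(** If [u] is not in the closed set [U y], then [U y] lies in the open complement [V] of the closure
    of a small ball around [u]. Upper semicontinuity keeps [U y'] inside [V] for [y'] near [y] in
    [Y], so a whole neighbourhood of [(y, u)] misses the graph. *)
Lemma closed_graph : closed (graph Y U).
Proof.
have clY : closed Y by apply: compact_closed => //; exact: norm_hausdorff.
move=> [y u] clyu.
have Yy : Y y.
  apply: clY => V Vy.
  have [|[y' u'] [[/= Yy' _] [/= Vy' _]]] := clyu (V `*` setT).
    by exists (V, setT) => //; split => //; exact: filterT.
  by exists y'.
split => //=; apply: contrapT => Uyu.
have clU : closed (U y) by apply: compact_closed; [exact: metric_hausdorff|exact: cU].
have /nbhs_ballP[e /= e0 eU] : nbhs u (~` U y).
  by apply: open_nbhs_nbhs; split => //; exact: closed_openC.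
have e20 : 0 < e / 2 by rewrite divr_gt0.
pose V := ~` closure (ball u (e / 2)).
have oV : open V by apply: closed_openC; exact: closed_closure.
have UV : U y `<=` V.
  move=> x Ux /(_ _ (nbhsx_ballx x _ e20))[z [uz xz]].
  apply: (eU x) => //; rewrite (splitr e).
  by apply: ball_triangle uz _; exact: ball_sym.
have := uscU Yy oV UV; rewrite /within => yV.
have [|[y' u'] [[/= Yy' Uu'] [/= Vy' uu']]] :=
  clyu ([set y' | Y y' -> U y' `<=` V] `*` ball u (e / 2)).
  by exists ([set y' | Y y' -> U y' `<=` V], ball u (e / 2)) => //;
    split => //=; exact: nbhsx_ballx.
by apply: (Vy' Yy' u' Uu'); exact: subset_closure.
Qed.

Lemma compact_graph : compact (graph Y U).
Proof.
apply: (@subclosed_compact _ _ (Y `*` setT)); first exact: closed_graph.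
- exact: compact_setX.
- by move=> [y u] [].
Qed.

End graph.

(** * Integration against combinations of measures and against charges *)

Lemma finite_measure_combination (R : realType) d (X : measurableType d)
    (N : nat) (c : nat -> {nonneg R})
    (m_ : nat -> {finite_measure set X -> \bar R}) :
  exists m : {finite_measure set X -> \bar R},
    forall A, m A = (\sum_(i < N) (c i)%:num%:E * m_ i A)%E.
Proof.
pose m := msum (fun i => mscale (c i) (m_ i)) N.
have mfin : fin_num_fun m.
  move=> A mA; rewrite /m /msum sum_fin_num.
  by apply/allP => _ /mapP[i _ ->]; exact: fin_num_measure.
pose m' : {finite_measure set X -> \bar R} := HB.pack (m : set X -> \bar R)
  (Measure.class m) (@Measure_isFinite.Build _ _ _ m mfin).
by exists m'.
Qed.

(** The identity between measures is asked on subsets of [D] only, because [Gamma] prescribes its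
    elements just on subsets of the graph. *)
Lemma Rintegral_measure_combination (R : realType) d (X : measurableType d)
    (N : nat) (c : nat -> {nonneg R}) (m : {finite_measure set X -> \bar R})
    (m_ : nat -> {finite_measure set X -> \bar R}) (D : set X) (q : X -> R)
    (M : R) : measurable D ->
  (forall A, measurable A -> A `<=` D ->
    m A = (\sum_(i < N) (c i)%:num%:E * m_ i A)%E) ->
  measurable_fun D q -> (forall x, D x -> `|q x| <= M) ->
  \int[m]_(x in D) q x = \sum_(i < N) (c i)%:num * \int[m_ i]_(x in D) q x.
Proof.
move=> mD mE mq qM.
(* The integral formula is available for nonnegative functions; apply it to q + K
   and to K. *)
pose K := `|M|.
have qK x : D x -> `|q x| <= K by move=> /qM/le_trans; apply; exact: ler_norm.
have int (nu : {finite_measure set X -> \bar R}) (g : X -> R) :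
    measurable_fun D g -> (forall x, D x -> 0 <= g x <= K + K) ->
    nu.-integrable D (EFin \o g).
  move=> mg g0K; apply: (@bounded_integrable _ _ _ nu D g (K + K)) => //.
  by move=> x Dx; have /andP[g0 gK] := g0K _ Dx; rewrite ger0_norm.
have pos (g : X -> R) : measurable_fun D g ->
    (forall x, D x -> 0 <= g x <= K + K) ->
    \int[m]_(x in D) g x = \sum_(i < N) (c i)%:num * \int[m_ i]_(x in D) g x.
  move=> mg g0K; have mEg : measurable_fun D (EFin \o g).
    exact/measurable_EFinP.
  have g0 x : D x -> (0 <= (g x)%:E)%E.
    by move=> /g0K/andP[+ _]; rewrite lee_fin.
  rewrite /Rintegral (eq_measure_integral (msum (fun i => mscale (c i) (m_ i)) N)).
    rewrite ge0_integral_measure_sum//.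
    transitivity (fine (\sum_(i < N)
        ((c i)%:num * \int[m_ i]_(x in D) g x)%:E)%E); last by rewrite sumEFin.
    congr fine; apply: eq_bigr => i _; rewrite ge0_integral_mscale// EFinM.
    by rewrite fineK//; apply: integrable_fin_num => //; exact: int.
  by move=> A mA AD; exact: mE.
have mqK : measurable_fun D (fun x => q x + K) by exact: measurable_funD.
have qK0 x : D x -> 0 <= q x + K <= K + K.
  by move=> /qK; rewrite ler_norml lerD2r -lerBlDr sub0r.
have K0 x : D x -> 0 <= cst K x <= K + K.
  by rewrite /= lerDl normr_ge0.
have shift (nu : {finite_measure set X -> \bar R}) :
  \int[nu]_(x in D) q x =
  \int[nu]_(x in D) (q x + K) - \int[nu]_(x in D) cst K x.
  rewrite -RintegralB//; [|exact: int|exact: int].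
  by apply: eq_Rintegral => x _; rewrite addrK.
rewrite shift !pos// -sumrB; apply: eq_bigr => i _.
by rewrite -mulrBr -shift.
Qed.

(** The negative set of a Hahn decomposition need not be empty, but a measure is both nonnegative
    and nonpositive on its subsets, so it vanishes there. *)
Lemma jordan_neg_finite_measure (R : realType) d (X : measurableType d)
    (m : {finite_measure set X -> \bar R}) (A N : set X)
    (mAN : hahn_decomposition (charge_of_finite_measure m) A N) (B : set X) :
  measurable B -> jordan_neg mAN B = 0%E.
Proof.
move=> mB; rewrite jordan_negE cjordan_negE /crestr0 mem_set//= /crestr.
have [_ [mN negN] _ _] := mAN.
have : (m (B `&` N) <= 0)%E.
  by apply: negN; [exact: measurableI|exact: subIsetr].
by rewrite measure_le0 => /eqP; rewrite /charge_of_finite_measure => ->; rewrite oppe0.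
Qed.

(** [D1] is a set of charges, whereas limits of occupational measures are probabilities; this lets
    the integral in [D1] be read as an ordinary one. *)
Lemma charge_integral_finite_measure (R : realType) d (X : measurableType d)
    (m : {finite_measure set X -> \bar R}) (D : set X) (q : X -> R) :
  charge_integral (charge_of_finite_measure m) D q = \int[m]_(x in D) q x.
Proof.
rewrite /charge_integral /Rintegral.
rewrite (eq_measure_integral m); last first.
  move=> B mB _; rewrite -[RHS]/(charge_of_finite_measure m B).
  rewrite (jordan_decomp (hahnP (charge_of_finite_measure m)) mB).
  rewrite /cadd /= /cscale.
  by rewrite [X in (_ + _ * X)%E](jordan_neg_finite_measure _ mB) mule0 adde0.
rewrite [X in _ - fine X](eq_measure_integral mzero); last first.
  by move=> B mB _; exact: jordan_neg_finite_measure.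
by rewrite integral_measure_zero/= subr0.
Qed.

Lemma within_continuous_within_comp (X Y Z : topologicalType) (A : set X) (B : set Y)
    (g : X -> Y) (h : Y -> Z) :
  {within A, continuous g} -> {within B, continuous h} ->
  (forall x, A x -> B (g x)) -> {within A, continuous (h \o g)}.
Proof.
move=> /subspace_continuousP cg /subspace_continuousP ch gAB.
apply/subspace_continuousP => x Ax V /(ch _ (gAB _ Ax)) hV.
have {}hV : nbhs (g x) [set y | B y -> V (h y)] by exact: hV.
have gV : nbhs x [set y | A y -> B (g y) -> V (h (g y))] by exact: (cg x Ax _ hV).
suff : nbhs x [set y | A y -> V (h (g y))] by [].
by apply: filterS gV => y /= H Ay; exact: H Ay (gAB _ Ay).
Qed.

Lemma compact_within_bounded (R : realType) (X : topologicalType) (A : set X)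
    (g : X -> R) : compact A -> {within A, continuous g} ->
  exists M : R, forall x, A x -> `|g x| <= M.
Proof.
move=> cA cg; have := continuous_compact cg cA.
move=> /compact_bounded[M [_ HM]]; exists (M + 1) => x Ax.
by apply: (HM (M + 1)); [rewrite ltrDl|exists x].
Qed.

Lemma Rintegral_cst_probability (R : realType) d (X : measurableType d)
    (P : probability X R) (r : R) : \int[P]_x r = r.
Proof.
rewrite Rintegral_cst//; have := congr1 fine (probability_setT P) => /= P1.
exact: etrans (congr1 (fun x => r * x) P1) (mulr1 r).
Qed.

(** * Regularity of the dynamics and of the trajectories *)

Section controlled_process.
Context (R : realType) (n : nat) (Uh : pmetricType R) (S : ptopologicalType)
  (Y : set 'rV[R]_n) (U : 'rV[R]_n -> set Uh)
  (f : 'rV[R]_n -> Uh -> S -> 'rV[R]_n)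
  (d : measure_display) (Omega : measurableType d) (P : probability Omega R)
  (s : nat -> Omega -> S) (mu : probability (borel S) R).
Hypotheses (cY : compact Y) (cUh : compact [set: Uh]).
Hypothesis cf : forall x, {within Y `*` [set: Uh],
  continuous (fun p : 'rV[R]_n * Uh => f p.1 p.2 x)}.
Hypothesis mf : forall y u, Y y ->
  measurable_fun [set: borel S] (f y u : borel S -> borel 'rV[R]_n).
Hypothesis iids : iid P (s : nat -> Omega -> borel S) mu.
Hypothesis uscU : upper_semicontinuous_on Y U.
Hypothesis cU : forall y, Y y -> compact (U y).
Hypothesis fY : forall y u x, Y y -> U y u -> Y (f y u x).

Local Notation XU := ('rV[R]_n * Uh)%type.
Local Notation G := (graph Y U).
Local Notation past t := (g_sigma_algebraType
  (@past_cylinder _ _ Omega (borel S) s t)).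

Lemma measurable_graph : measurable (G : set (borel XU)).
Proof.
rewrite -[X in measurable X]setCK; apply: measurableC.
apply: sub_sigma_algebra; apply: closed_openC.
exact: closed_graph.
Qed.

Lemma measurable_state_space : measurable (Y : set (borel 'rV[R]_n)).
Proof.
rewrite -[X in measurable X]setCK; apply: measurableC.
apply: sub_sigma_algebra; apply: closed_openC.
by apply: compact_closed => //; exact: norm_hausdorff.
Qed.

Lemma within_graph_dynamics x :
  {within G, continuous (fun p : XU => f p.1 p.2 x)}.
Proof.
have GY : G `<=` Y `*` [set: Uh] by move=> p [].
exact: (continuous_subspaceW GY (@cf x)).
Qed.

Section test_function.
Variable phi : 'rV[R]_n -> R.
Hypothesis cphi : {within Y, continuous phi}.

Lemma within_graph_test x :
  {within G, continuous (fun p : XU => phi (f p.1 p.2 x))}.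
Proof.
apply: (@within_continuous_within_comp XU _ _ G Y _ phi (@within_graph_dynamics x)
  cphi) => p [].
exact: fY.
Qed.

Lemma within_graph_fst : {within G, continuous (fun p : XU => phi p.1)}.
Proof.
apply: (within_continuous_within_comp (g := fst) _ cphi); last by move=> p [].
by apply: continuous_subspaceT => p; exact: cvg_fst.
Qed.

Lemma measurable_test_next y u : Y y -> U y u ->
  measurable_fun [set: borel S] (fun x : borel S => phi (f y u x)).
Proof.
move=> Yy Uyu; apply: open_measurable_realfun.
apply: (within_continuous_measurable cphi); last by move=> x _; exact: fY.
by apply/(measurable_fun_g_sigma_algebra _ _ measurableT); exact: mf.
Qed.

(** On the graph the next state stays in [Y] by [fY], where [phi] is bounded by compactness. This
    bound dominates the integrands. *)
Lemma within_graph_mean_next :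
  {within G, continuous (fun p : XU => mean_next f mu phi p.1 p.2)}.
Proof.
have [M phiM] := compact_within_bounded cY cphi.
apply: (@within_continuous_Rintegral _ _ _ mu _ G
  (fun p x => phi (f p.1 p.2 x)) M).
- by move=> p [/= Yp Up]; exact: measurable_test_next.
- by move=> p x [/= Yp Up]; apply: phiM; exact: fY.
- exact: within_graph_test.
Qed.

End test_function.

Section trajectory.
Variables (pi : nat -> 'rV[R]_n -> Uh) (y0 : 'rV[R]_n).
Hypotheses (planpi : plan Y U pi) (Yy0 : Y y0).

Lemma state_in t w : Y (state f s pi y0 t w).
Proof.
elim: t => [//|t IHt] /=; apply: fY => //.
by have [_] := planpi t; apply.
Qed.

Lemma state_control_in t w :
  G (state f s pi y0 t w, control f s pi y0 t w).
Proof.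
split; first exact: state_in.
by have [_] := planpi t; apply; exact: state_in.
Qed.

(** A plan is measurable on [Y] only, so the preimage of an open set is first cut down to [Y]; this
    changes nothing along a trajectory, which never leaves [Y]. *)
Lemma control_measurable_of_state t :
  open_measurable_fun (X := past t) setT (state f s pi y0 t) ->
  open_measurable_fun (X := past t) setT (control f s pi y0 t).
Proof.
move=> mst V oV; have [mpi _] := planpi t.
have mV : measurable (Y `&` pi t @^-1` V : set (borel 'rV[R]_n)).
  by apply: mpi; [exact: measurable_state_space|exact: sub_sigma_algebra].
have mst' : measurable_fun setT (state f s pi y0 t : past t -> borel 'rV[R]_n).
  exact/measurable_fun_g_sigma_algebra.
rewrite [X in measurable X](_ : _ =
    setT `&` state f s pi y0 t @^-1` (Y `&` pi t @^-1` V)); first exact: mst'.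
apply/seteqP; split=> w [_ /= Vw]; split => //=; last by case: Vw.
by split => //; exact: state_in.
Qed.

(** Induction on time. The dynamics are continuous in the pair and measurable in the noise
    separately, so the next state is a Carathéodory map on the compact graph, evaluated at the
    current pair. The pair depends on the past of [t], and [s t] enters the past of [t.+1]. *)
Lemma state_past_measurable t :
  open_measurable_fun (X := past t) setT (state f s pi y0 t).
Proof.
elim: t => [|t IHt].
  have : measurable_fun setT (cst y0 : past 0 -> borel 'rV[R]_n) by [].
  by move/(measurable_fun_g_sigma_algebra _ _ measurableT).
have ict := control_measurable_of_state IHt.
have pastS h : open_measurable_fun (X := past t) setT h ->
    open_measurable_fun (X := past t.+1) setT (h : Omega -> XU).
  by move=> mh V oV; apply: past_measurableS; exact: mh.
apply: (@measurable_caratheodory_fun _ _ (past t.+1) XU 'rV[R]_n G setT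
  (fun w => (state f s pi y0 t w, control f s pi y0 t w))
  (fun p w => f p.1 p.2 (s t w))) => //.
- exact: compact_graph.
- by apply: pastS; exact: open_measurable_fun_pair.
- by move=> w _; exact: state_control_in.
- move=> [y u] [/= Yy Uu]; apply/(measurable_fun_g_sigma_algebra _ _ measurableT).
  apply: (measurableT_comp (mf u Yy)).
  exact: (@measurable_past_last _ _ Omega (borel S)).
- by move=> w _; exact: within_graph_dynamics.
Qed.

Lemma state_control_past_measurable t : measurable_fun setT
  ((fun w => (state f s pi y0 t w, control f s pi y0 t w))
    : past t -> borel XU).
Proof.
apply/(measurable_fun_g_sigma_algebra _ _ measurableT).
have mst := @state_past_measurable t.
by apply: open_measurable_fun_pair => //; exact: control_measurable_of_state.
Qed.

End trajectory.

(** * Laws of the state-control pairs, and occupational measures *)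

Section law.
Variables (pi : nat -> 'rV[R]_n -> Uh) (y0 : 'rV[R]_n).
Hypotheses (planpi : plan Y U pi) (Yy0 : Y y0).

Local Notation st t w := (state f s pi y0 t w).
Local Notation ct t w := (control f s pi y0 t w).

Lemma state_control_measurable t : measurable_fun setT
  ((fun w => (st t w, ct t w)) : Omega -> borel XU).
Proof.
apply: (past_measurable_fun iids).
exact: (state_control_past_measurable planpi Yy0).
Qed.

Definition state_control t : {mfun Omega >-> borel XU} :=
  HB.pack ((fun w => (st t w, ct t w)) : Omega -> borel XU)
    (isMeasurableFun.Build _ _ _ _ _ (state_control_measurable t)).

Lemma expectation_next (phi : 'rV[R]_n -> R) t :
  {within Y, continuous phi} ->
  \int[P]_w phi (st t.+1 w) =
  \int[P]_w mean_next f mu phi (st t w) (ct t w).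
Proof.
move=> cphi; have [M phiM] := compact_within_bounded cY cphi.
pose D : set (borel XU * borel S) := G `*` setT.
have mD : measurable D by apply: measurableX => //; exact: measurable_graph.
(* Off the graph [phi (f y u x)] is under no control. Extended by zero outside [D], it is bounded
   and measurable on the whole product, and [HE] shows that trajectories do not notice the
   change. *)
pose H := (fun q : borel XU * borel S => phi (f q.1.1 q.1.2 q.2)) \_ D.
have [ms _ _] := iids.
pose st_ : {mfun Omega >-> borel S} := HB.pack (s t : Omega -> borel S)
  (isMeasurableFun.Build _ _ _ _ _ (ms t)).
have mfst : open_measurable_fun D (fst : borel XU * borel S -> XU).
  move=> V oV; apply: measurableI => //.
  rewrite -[X in measurable X]setTI; apply: measurable_fst => //.
  exact: sub_sigma_algebra.
have mH : measurable_fun setT H.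
  apply/(measurable_restrictT _ mD); apply: open_measurable_realfun.
  apply: (@measurable_caratheodory_fun _ _ _ XU R G D fst
    (fun p q => phi (f p.1 p.2 q.2))) => //.
  - exact: compact_graph.
  - by move=> q [].
  - move=> p [/= Yp Up]; apply: measurable_realfun_open => //.
    apply: measurable_funTS.
    exact: (measurableT_comp (measurable_test_next cphi Yp Up)).
  - by move=> q _; exact: within_graph_test.
have HE w x : H ((st t w, ct t w), x) = phi (f (st t w) (ct t w) x).
  rewrite /H patchE mem_set//; split => //.
  exact: state_control_in.
have HM q : `|H q| <= `|M|.
  rewrite /H patchE; case: ifPn => [|_]; last by rewrite normr0.
  rewrite inE => -[[/= Yq Uq] _]; apply: le_trans (ler_norm M).
  by apply: phiM; exact: fY.
have hs A B : measurable A -> measurable B ->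
    P (state_control t @^-1` A `&` st_ @^-1` B) =
    (P (state_control t @^-1` A) * mu B)%E.
  (* Measurability with respect to the past of [t], and not merely over [Omega], is what counts
     here. *)
  move=> mA mB; apply: (past_independent iids) => //.
  rewrite -[X in measurable X]setTI.
  by apply: (state_control_past_measurable planpi Yy0 (t := t)).
have := Rintegral_independent hs mH HM.
rewrite /mean_next /=.
under eq_Rintegral do rewrite HE.
by under [in X in _ = X -> _]eq_Rintegral do under eq_Rintegral do rewrite HE.
Qed.

Lemma measurable_within_graph (q : XU -> R) : {within G, continuous q} ->
  measurable_fun (G : set (borel XU)) (q : borel XU -> R).
Proof.
move=> cq; apply: open_measurable_realfun.
apply: (@within_continuous_measurable _ (borel XU) XU R G G q id) => //.
move=> V oV; apply: measurableI; first exact: measurable_graph.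
exact: sub_sigma_algebra.
Qed.

Lemma within_graph_increment (phi : 'rV[R]_n -> R) : {within Y, continuous phi} ->
  {within G, continuous (fun p : XU => mean_next f mu phi p.1 p.2 - phi p.1)}.
Proof.
move=> cphi p; apply: cvgB; first exact: within_graph_mean_next.
exact: within_graph_fst.
Qed.

Definition law t : {finite_measure set (borel XU) -> \bar R} :=
  distribution P (state_control t).

Lemma concentrated_law t : concentrated_on (law t) G.
Proof.
move=> A _ AG; rewrite -(measure0 P); congr (P _).
rewrite -subset0 => w /= Aw; have : (A `&` G) (st t w, ct t w).
  by split => //; exact: state_control_in.
by rewrite AG.
Qed.

Lemma Rintegral_law (q : XU -> R) t : {within G, continuous q} ->
  \int[law t]_(p in G) q p = \int[P]_w q (st t w, ct t w).
Proof.
move=> cq; have cG : compact G by exact: compact_graph.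
have [M qM] := compact_within_bounded cG cq.
have mq : measurable_fun setT (q \_ G : borel XU -> R).
  apply/(measurable_restrictT _ measurable_graph).
  exact: measurable_within_graph.
rewrite Rintegral_mkcond /Rintegral /law.
rewrite (@integral_distribution _ _ _ _ _ P (state_control t) (EFin \o (q \_ G))).
- congr fine; apply: eq_integral => w _ /=; rewrite patchE mem_set//.
  exact: state_control_in.
- exact/measurable_EFinP.
- apply: (@bounded_integrable _ _ _ P setT
    ((q \_ G) \o state_control t) M) => //.
    exact: measurableT_comp.
  move=> w _ /=; rewrite patchE mem_set//; last exact: state_control_in.
  by apply: qM; exact: state_control_in.
Qed.

Lemma integrable_state_control (q : XU -> R) t : {within G, continuous q} ->
  P.-integrable setT (EFin \o (fun w => q (st t w, ct t w))).
Proof.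
move=> cq; have cG : compact G by exact: compact_graph.
have [M qM] := compact_within_bounded cG cq.
apply: (@bounded_integrable _ _ _ P setT _ M) => //.
  apply: open_measurable_realfun; apply: (within_continuous_measurable cq).
    apply/(measurable_fun_g_sigma_algebra _ _ measurableT).
    exact: state_control_measurable.
  by move=> w _; exact: state_control_in.
by move=> w _; apply: qM; exact: state_control_in.
Qed.

Lemma Rintegral_law_increment (phi : 'rV[R]_n -> R) t :
  {within Y, continuous phi} ->
  \int[law t]_(p in G) (mean_next f mu phi p.1 p.2 - phi p.1) =
  \int[P]_w phi (st t.+1 w) - \int[P]_w phi (st t w).
Proof.
move=> cphi; rewrite (Rintegral_law t (within_graph_increment cphi)).
rewrite expectation_next//= RintegralB//.
- exact: (integrable_state_control t (within_graph_mean_next cphi)).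
- exact: (integrable_state_control t (within_graph_fst cphi)).
Qed.

Lemma occupational_law (T : nat) (Q : set (borel XU)) : measurable Q ->
  occupational f P s pi y0 T Q =
  (\sum_(i < T) (T%:R^-1)%:E * law i Q)%E.
Proof.
move=> mQ; have mpre i : measurable (state_control i @^-1` Q).
  rewrite -[X in measurable X]setTI.
  exact: (measurable_funP (state_control i)).
rewrite /occupational unlock -ge0_sume_distrr//.
congr (_ * _)%E.
under eq_integral do rewrite -sumEFin big_mkord.
rewrite ge0_integral_sum//.
- apply: eq_bigr => i _.
  transitivity (\int[P]_w (\1_(state_control i @^-1` Q) w)%:E)%E.
    by apply: eq_integral => w _; rewrite !indicE.
  by rewrite integral_indic// setIT.
- by move=> i; apply/measurable_EFinP; exact: (measurable_indic (mpre i)).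
Qed.

Section occupation.
Variables (T : nat) (gam : probability (borel XU) R).
Hypothesis gamE : forall Q : set (borel XU), measurable Q -> Q `<=` G ->
  gam Q = occupational f P s pi y0 T Q.

Let T0 : 0 <= T%:R^-1 :> R. Proof. by rewrite invr_ge0. Qed.

Lemma Rintegral_occupation (q : XU -> R) : {within G, continuous q} ->
  \int[gam]_(p in G) q p = T%:R^-1 * \sum_(i < T) \int[law i]_(p in G) q p.
Proof.
move=> cq; have cG : compact G by exact: compact_graph.
have [M qM] := compact_within_bounded cG cq.
rewrite (@Rintegral_measure_combination _ _ _ T (fun=> NngNum T0) gam law G q M)
  ?mulr_sumr//.
- exact: measurable_graph.
- by move=> A mA AG; apply: (etrans (gamE mA AG)); exact: occupational_law.
- exact: measurable_within_graph.
Qed.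

Lemma Rintegral_occupation_increment (phi : 'rV[R]_n -> R) :
  {within Y, continuous phi} ->
  \int[gam]_(p in G) (mean_next f mu phi p.1 p.2 - phi p.1) =
  T%:R^-1 * (\int[P]_w phi (st T w) - phi y0).
Proof.
move=> cphi; rewrite Rintegral_occupation; last exact: within_graph_increment.
under eq_bigr do rewrite Rintegral_law_increment//.
rewrite -(big_mkord xpredT (fun i => \int[P]_w phi (st i.+1 w) -
  \int[P]_w phi (st i w))) telescope_sumr//=.
by rewrite Rintegral_cst_probability.
Qed.

(** Each [a t - a 0] telescopes into the increments before time [t]. After exchanging the two sums,
    the law at time [i] carries the weight [(T - i - 1) / T]. For positive [T] the coefficients add
    up to [(T - 1) / 2], so the measures [xi] are finite but their masses grow with [T]. *)
Lemma occupation_potential : exists xi : {finite_measure set (borel XU) -> \bar R},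
  concentrated_on xi G /\
  forall phi : 'rV[R]_n -> R, {within Y, continuous phi} ->
    \int[gam]_(p in G) (phi p.1 - phi y0) =
    \int[xi]_(p in G) (mean_next f mu phi p.1 p.2 - phi p.1).
Proof.
(* T - i.+1 counts the t < T with i < t. *)
have c0 i : 0 <= T%:R^-1 * (T - i.+1)%:R :> R by rewrite mulr_ge0.
have [xi xiE] := finite_measure_combination T (fun i => NngNum (c0 i)) law.
exists xi; split=> [A mA AG|phi cphi].
  by rewrite xiE big1// => i _; rewrite concentrated_law// mule0.
have cG : compact G by exact: compact_graph.
have cq := within_graph_increment cphi.
have [M qM] := compact_within_bounded cG cq.
rewrite (@Rintegral_measure_combination _ _ _ T (fun i => NngNum (c0 i)) xi law G
  (fun p => mean_next f mu phi p.1 p.2 - phi p.1) M) //; last 2 first.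
- exact: measurable_graph.
- exact: measurable_within_graph.
have c1 : {within G, continuous (fun p : XU => phi p.1 - phi y0)}.
  move=> p; apply: cvgB; first exact: within_graph_fst.
  exact: cvg_cst.
rewrite (Rintegral_occupation c1).
pose a i := \int[P]_w phi (st i w).
have aE i : \int[law i]_(p in G) (phi p.1 - phi y0) = a i - a 0%N.
  rewrite (Rintegral_law i c1) RintegralB//=.
  - exact: (integrable_state_control i (within_graph_fst cphi)).
  - exact: finite_measure_integrable_cst.
under eq_bigr do rewrite aE.
under [RHS]eq_bigr do rewrite Rintegral_law_increment// -mulrA.
rewrite -mulr_sumr; congr (_ * _).
(* Summation by parts, by induction on [N]: a further step raises each earlier weight by one, which
   adds the telescoping sum [a N - a 0], while the new last weight is zero. *)
suff sumE N : \sum_(i < N) (a i - a 0%N) =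
  \sum_(i < N) (N - i.+1)%:R * (a i.+1 - a i) by exact: sumE.
elim: N => [|N IHN]; first by rewrite !big_ord0.
rewrite !big_ord_recr/= IHN subnn mul0r addr0.
have -> : a N - a 0%N = \sum_(i < N) (a i.+1 - a i).
  by rewrite -(big_mkord xpredT (fun i => a i.+1 - a i)) telescope_sumr.
rewrite -big_split; apply: eq_bigr => i _ /=.
by rewrite -[X in _ + X]mul1r -mulrDl subSn// -natr1.
Qed.

End occupation.
End law.

(** * Passage to the weak limit *)

Section limit.
Variables (y0 : 'rV[R]_n) (gam : probability (borel XU) R).
Hypotheses (Yy0 : Y y0) (gamG : concentrated_on gam G).
Variables (T_ : nat -> nat) (gam_ : nat -> probability (borel XU) R).
Hypotheses (T_oo : T_ @ \oo --> \oo)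
  (gam_Gamma : forall l, Gamma Y U f P s y0 (T_ l) (gam_ l))
  (gam_cvg : forall q : XU -> R, {within G, continuous q} ->
     \int[gam_ l]_(p in G) q p @[l --> \oo] --> \int[gam]_(p in G) q p).

Lemma limit_in_W : W Y U f mu gam.
Proof.
split => // phi cphi; have cq := within_graph_increment cphi.
(* The integrals against [gam_ l] tend to the one against [gam]; it remains to see that they also
   tend to zero. *)
apply: (cvg_unique _ (gam_cvg cq)) => //.
have [M phiM] := compact_within_bounded cY cphi.
have bound l : `|\int[gam_ l]_(p in G)
    (mean_next f mu phi p.1 p.2 - phi p.1)| <= (T_ l)%:R^-1 * (M + M).
  have [_ [pi planpi gamE]] := gam_Gamma l.
  rewrite (Rintegral_occupation_increment planpi Yy0 gamE cphi).
  rewrite normrM ger0_norm ?invr_ge0// ler_wpM2l ?invr_ge0//.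
  apply: (le_trans (ler_normB _ _)); rewrite lerD ?phiM//.
  have mphi : P.-integrable setT
      (EFin \o (fun w => phi (state f s pi y0 (T_ l) w))).
    exact: (integrable_state_control planpi Yy0 _ (within_graph_fst cphi)).
  apply: (le_trans (le_normr_Rintegral measurableT mphi)).
  rewrite -[leRHS](Rintegral_cst_probability P); apply: le_Rintegral => //.
  - by have := integrable_norm mphi.
  - exact: finite_measure_integrable_cst.
  - by move=> w _; apply: phiM; exact: (state_in planpi Yy0).
(* The inverse of zero is zero by convention; shifting the index by one leaves the harmonic
   sequence. *)
have inv0 : (fun k : nat => k%:R^-1 : R) @ \oo --> (0 : R).
  by rewrite -cvg_shiftS; exact: cvg_harmonic.
have bound0 : (fun l => (T_ l)%:R^-1 * (M + M)) @ \oo --> (0 : R).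
  have Tinv : (fun l => (T_ l)%:R^-1 : R) @ \oo --> (0 : R).
    exact: (cvg_comp _ _ T_oo inv0).
  have := cvgM Tinv (cvg_cst (M + M)); rewrite mul0r; exact.
apply: norm_cvg0; apply: (squeeze_cvgr _ (cvg_cst 0) bound0).
by apply: nearW => l; rewrite normr_ge0 bound.
Qed.

(** The measures [xi l] are chosen before the test function, as [D1] demands. For each [l] the
    identity is exact, so the limit in [D1] is that of the integrals of [phi - phi y0] against
    [gam_ l], given by weak convergence. *)
Lemma limit_in_D1 : D1 Y U f mu y0 (charge_of_finite_measure gam).
Proof.
split; first exact: gamG.
have /choice[xi xiP] l : exists xi : {finite_measure set (borel XU) -> \bar R},
    concentrated_on xi G /\
    forall phi : 'rV[R]_n -> R, {within Y, continuous phi} ->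
      \int[gam_ l]_(p in G) (phi p.1 - phi y0) =
      \int[xi]_(p in G) (mean_next f mu phi p.1 p.2 - phi p.1).
  have [_ [pi planpi gamE]] := gam_Gamma l.
  exact: (occupation_potential planpi Yy0 gamE).
exists xi; split=> [l|phi cphi]; first by have [] := xiP l.
rewrite charge_integral_finite_measure.
under eq_fun do rewrite -(xiP _).2//.
apply: gam_cvg => p; apply: cvgB; first exact: within_graph_fst.
exact: cvg_cst.
Qed.

End limit.

Lemma limsup_Gamma_sub (y0 : 'rV[R]_n) : Y y0 ->
  limsup_Gamma Y U f P s y0 `<=` W Y U f mu `&`
  [set gam : probability (borel XU) R |
     D1 Y U f mu y0 (charge_of_finite_measure gam)].
Proof.
move=> Yy0 gam [gamG [T_ [gam_ [T_oo gam_Gamma gam_cvg]]]]; split.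
  exact: (limit_in_W Yy0 gamG T_oo gam_Gamma gam_cvg).
exact: (limit_in_D1 Yy0 gamG gam_Gamma gam_cvg).
Qed.

End controlled_process.

Theorem proposition5p1 (R : realType) (n : nat)
  (Uh : pmetricType R) (S : ptopologicalType)
  (Y : set 'rV[R]_n) (U : 'rV[R]_n -> set Uh)
  (f : 'rV[R]_n -> Uh -> S -> 'rV[R]_n)
  (d : measure_display) (Omega : measurableType d) (P : probability Omega R)
  (s : nat -> Omega -> S) (mu : probability (borel S) R) :
  compact Y -> Y !=set0 ->
  compact [set: Uh] ->
  polish_space R S ->
  (exists M : R, forall y u x, Y y -> `|f y u x| <= M) ->
  (forall x, {within Y `*` [set: Uh],
     continuous (fun p : 'rV[R]_n * Uh => f p.1 p.2 x)}) ->
  (forall y u, Y y ->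
     measurable_fun [set: borel S] (f y u : borel S -> borel 'rV[R]_n)) ->
  iid P (s : nat -> Omega -> borel S) mu ->
  upper_semicontinuous_on Y U ->
  (forall y, Y y -> U y !=set0 /\ compact (U y)) ->
  (forall y u x, Y y -> U y u -> Y (f y u x)) ->
  forall y0, Y y0 ->
    limsup_Gamma Y U f P s y0 `<=`
    W Y U f mu `&`
    [set gam : probability (borel ('rV[R]_n * Uh)%type) R |
       D1 Y U f mu y0 (charge_of_finite_measure gam)].
Proof.
move=> cY _ cUh _ _ cf mf iids uscU cU fY y0 Yy0.
by apply: (limsup_Gamma_sub cY cUh cf mf iids uscU _ fY Yy0) => y /cU[].
Qed.
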